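(* For $n\in\mathbb{Z}^+$ we have $$\begin{aligned}&t(3,4,5;n)=2N(3,4,5;2n+3)&&\text{for } n\equiv 3\pmod 4,\\ &t(3,5,20;n)=2N(3,5,20;2n+7)&&\text{for } n\equiv 1\pmod 4,\\ &t(3,5,36;n)=2N(3,5,36;2n+11)&&\text{for } n\equiv 3\pmod 4,\\ &t(3,5,12;n)=\tfrac 12N(3,5,12;8n+20)&&\text{for } n\equiv 1\pmod 4.\end{aligned}$$
   Context: $\mathbb{Z}^+$ is the set of positive integers. For $a,b,c\in\mathbb{Z}^+$ and nonnegative integer $n$, $N(a,b,c;n)$ denotes the number of triples $(x,y,z)\in\mathbb{Z}^3$ with $n=ax^2+by^2+cz^2$, and $t(a,b,c;n)$ denotes the number of triples $(x,y,z)\in\mathbb{Z}^3$ with $n=a\frac{x(x+1)}2+b\frac{y(y+1)}2+c\frac{z(z+1)}2$. *)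

(* Defs.v *)
From Stdlib Require Import ZArith List.
Import ListNotations.
Open Scope Z_scope.

Definition box (m : Z) : list Z :=
  map (fun k => k - (m + 1)) (map Z.of_nat (seq 0 (Z.to_nat (2 * m + 3)))).

(* Number of triples (x,y,z) in box(n)^3 satisfying P.  For a,b,c >= 1 and
   n >= 0, every integer solution of the equations below lies in this box
   (|x| <= n for squares; x(x+1)/2 <= n forces |x| <= n+1 for triangular
   numbers), so these counts equal the counts over all of Z^3. *)
Definition count3 (n : Z) (P : Z -> Z -> Z -> bool) : nat :=
  length (filter (fun t => match t with (x, (y, z)) => P x y z end)
    (list_prod (box n) (list_prod (box n) (box n)))).

Definition Nrep (a b c n : Z) : nat :=
  count3 n (fun x y z => Z.eqb n (a * x * x + b * y * y + c * z * z)).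

Definition trep (a b c n : Z) : nat :=
  count3 n (fun x y z =>
    Z.eqb n (a * (x * (x + 1) / 2) + b * (y * (y + 1) / 2) + c * (z * (z + 1) / 2))).

(* Main.v *)
(** Completing squares turns [t(a,b,c;n)] into the number of solutions of
    [a X^2 + b Y^2 + c Z^2 = 8 n + a + b + c] in odd integers.  The
    representations on the two sides are matched by rational isometries with
    2-power denominators: [X = x + 5 y], [Y = 3 x - y] gives
    [3 X^2 + 5 Y^2 = 48 x^2 + 80 y^2], and for [3 X^2 + 4 Y^2 + 5 Z^2] one writes
    [X = 32 k - 8 Y - 5 Z] and sends [(X, Y, Z)] to
    [(2 k, 3 k - Y, 12 k - 3 Y - 2 Z)], which divides the form by 4.  Such a map
    is integral only on solutions satisfying a congruence, which every solution
    meets for exactly one choice of certain signs; the number of free signs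
    accounts for the factors 2 and 1/2. *)
Require Import Defs.
From Stdlib Require Import ZArith List FinFun Lia.
Open Scope Z_scope.

Ltac Zify.zify_post_hook ::= Z.to_euclidean_division_equations.

Ltac lia_abstracting_products :=
  repeat match goal with
  | _ : context [?a * ?b] |- _ =>
      is_var a; is_var b; let p := fresh in set (p := a * b) in *; clearbody p
  | |- context [?a * ?b] =>
      is_var a; is_var b; let p := fresh in set (p := a * b) in *; clearbody p
  end; lia.

(** * Finite cardinality of predicates and its transport *)

Definition has_card {A : Type} (S : A -> Prop) (n : nat) : Prop :=
  exists l, NoDup l /\ length l = n /\ forall t, In t l <-> S t.

Lemma has_card_unique {A : Type} (S : A -> Prop) (m n : nat) :
  has_card S m -> has_card S n -> m = n.
Proof.
  intros (l & Hl & <- & HlS) (l' & Hl' & <- & HlS').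
  apply Nat.le_antisymm; apply NoDup_incl_length; auto; intros t Ht.
  - now apply HlS', HlS.
  - now apply HlS, HlS'.
Qed.

(** The maps used below contain integer divisions and invert each other only on solutions, so both
    inverse laws are required only on [S] and [T]. *)
Lemma has_card_bij {A B : Type} (f : A -> B) (g : B -> A)
    (S : A -> Prop) (T : B -> Prop) (n : nat) :
  (forall t, S t -> T (f t) /\ g (f t) = t) ->
  (forall t, T t -> S (g t) /\ f (g t) = t) ->
  has_card S n -> has_card T n.
Proof.
  intros Hf Hg (l & Hl & <- & HlS).
  exists (map f l); split; [|split].
  - assert (HS : forall t, In t l -> S t) by (intros t; apply HlS).
    clear HlS; induction Hl as [|a l Ha Hl IH]; constructor.
    + intros (b & Hb & Hin)%in_map_iff; apply Ha.
      rewrite <- (proj2 (Hf a (HS a (or_introl eq_refl)))), <- Hb.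
      now rewrite (proj2 (Hf b (HS b (or_intror Hin)))).
    + apply IH; intros t Ht; apply HS; now right.
  - apply length_map.
  - intros t; rewrite in_map_iff; split.
    + intros (s & <- & Hs); now apply Hf, HlS.
    + intros Ht; exists (g t); split; [now apply Hg|now apply HlS, Hg].
Qed.

Lemma has_card_ext {A : Type} (S T : A -> Prop) (n : nat) :
  (forall t, S t <-> T t) -> has_card S n -> has_card T n.
Proof.
  intros H; apply (has_card_bij (fun t => t) (fun t => t));
    intros t Ht; split; auto; now apply H.
Qed.

Lemma has_card_split {A : Type} (Q : A -> bool) (S : A -> Prop) (n : nat) :
  has_card S n -> exists p q,
    has_card (fun t => S t /\ Q t = true) p /\
    has_card (fun t => S t /\ Q t = false) q /\ n = (p + q)%nat.
Proof.
  intros (l & Hl & <- & HlS).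
  exists (length (filter Q l)), (length (filter (fun t => negb (Q t)) l)).
  split; [|split].
  - exists (filter Q l); split; [now apply NoDup_filter|split; [easy|]].
    intros t; rewrite filter_In, HlS; tauto.
  - exists (filter (fun t => negb (Q t)) l).
    split; [now apply NoDup_filter|split; [easy|]].
    intros t; rewrite filter_In, HlS, Bool.negb_true_iff; tauto.
  - now rewrite filter_length.
Qed.

(** The involution [f] exchanges the two halves of [S] cut out by [Q]. With a sign change or a swap
    of two variables as [f], each use contributes one factor 2. *)
Lemma has_card_halve {A : Type} (f : A -> A) (Q : A -> bool)
    (S : A -> Prop) (n : nat) :
  (forall t, S t -> S (f t) /\ f (f t) = t /\ Q (f t) = negb (Q t)) ->
  has_card S n ->
  exists p, has_card (fun t => S t /\ Q t = true) p /\ n = (2 * p)%nat.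
Proof.
  intros Hf (p & q & Hp & Hq & ->)%(has_card_split Q).
  exists p; split; [exact Hp|].
  enough (p = q) by lia.
  apply (has_card_unique _ _ _ Hp); revert Hq.
  apply (has_card_bij f f); intros t [Ht HQ];
    destruct (Hf t Ht) as (H1 & H2 & H3); rewrite HQ in H3; auto.
Qed.

Lemma square_mod_4 (x : Z) : (x * x) mod 4 = x mod 2.
Proof.
  destruct (Z.Even_or_Odd x) as [[k ->]|[k ->]].
  - replace (2 * k * (2 * k)) with (4 * (k * k)) by ring; lia.
  - replace ((2 * k + 1) * (2 * k + 1)) with (4 * (k * k + k) + 1) by ring; lia.
Qed.

Lemma triple_eq {A B C : Type} (x x' : A) (y y' : B) (z z' : C) :
  x = x' -> y = y' -> z = z' -> (x, (y, z)) = (x', (y', z')).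
Proof. now intros -> -> ->. Qed.

(** * From counts in boxes to counts over all integer triples *)

Lemma in_box (m x : Z) : 0 <= m -> (In x (box m) <-> - (m + 1) <= x <= m + 1).
Proof.
  intros Hm; unfold box; rewrite map_map, in_map_iff; split.
  - intros (k & <- & Hk%in_seq); lia.
  - intros Hx; exists (Z.to_nat (x + (m + 1))); rewrite in_seq; lia.
Qed.

Lemma NoDup_box (m : Z) : NoDup (box m).
Proof.
  unfold box; rewrite map_map; apply Injective_map_NoDup, seq_NoDup.
  intros i j; lia.
Qed.

Lemma NoDup_list_prod {A B : Type} (l : list A) (l' : list B) :
  NoDup l -> NoDup l' -> NoDup (list_prod l l').
Proof.
  intros Hl Hl'; induction Hl as [|a l Ha Hl IH]; simpl; [constructor|].
  apply NoDup_app; [|exact IH|].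
  - apply Injective_map_NoDup; [|exact Hl']; intros b c; congruence.
  - intros [b c] (d & Hd & _)%in_map_iff [Hb _]%in_prod_iff.
    injection Hd as -> ->; contradiction.
Qed.

Lemma has_card_count3 (n : Z) (P : Z -> Z -> Z -> bool) :
  0 <= n ->
  (forall x y z, P x y z = true ->
     - (n + 1) <= x <= n + 1 /\ - (n + 1) <= y <= n + 1 /\
     - (n + 1) <= z <= n + 1) ->
  has_card (fun '(x, (y, z)) => P x y z = true) (count3 n P).
Proof.
  intros Hn HP; unfold count3; eexists; split; [|split; [reflexivity|]].
  - apply NoDup_filter; repeat apply NoDup_list_prod; apply NoDup_box.
  - intros (x, (y, z)); rewrite filter_In, !in_prod_iff, !in_box by easy.
    split; [tauto|]; intros H; specialize (HP x y z H); tauto.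
Qed.

Lemma has_card_Nrep (a b c n : Z) :
  0 < a -> 0 < b -> 0 < c -> 0 <= n ->
  has_card (fun '(x, (y, z)) => a * (x * x) + b * (y * y) + c * (z * z) = n)
    (Nrep a b c n).
Proof.
  intros Ha Hb Hc Hn.
  eapply has_card_ext; [|apply has_card_count3; [exact Hn|]].
  - intros (x, (y, z)); simpl; rewrite Z.eqb_eq, <- !Z.mul_assoc; lia.
  - intros x y z; rewrite Z.eqb_eq, <- !Z.mul_assoc; intros H.
    assert (Hsq : forall d w, 0 < d -> 0 <= w * w <= d * (w * w)).
    { intros d w Hd; pose proof (Z.square_nonneg w) as Hw; split; [exact Hw|].
      rewrite <- (Z.mul_1_l (w * w)) at 1; apply Z.mul_le_mono_nonneg_r; lia. }
    pose proof (Hsq a x Ha); pose proof (Hsq b y Hb); pose proof (Hsq c z Hc).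
    repeat split; nia.
Qed.

Lemma triangular_odd_square (x : Z) :
  (2 * x + 1) * (2 * x + 1) = 8 * (x * (x + 1) / 2) + 1.
Proof.
  destruct (Z.Even_or_Odd x) as [[k ->]|[k ->]].
  - replace (2 * k * (2 * k + 1)) with (k * (2 * k + 1) * 2) by ring.
    rewrite Z.div_mul by easy; ring.
  - replace ((2 * k + 1) * (2 * k + 1 + 1)) with ((2 * k + 1) * (k + 1) * 2) by ring.
    rewrite Z.div_mul by easy; ring.
Qed.

Lemma odd_square (x : Z) : x mod 2 = 1 -> exists k, x * x = 8 * k + 1.
Proof.
  (* Since x = 2 (x / 2) + 1, the witness is the triangular number of x / 2. *)
  intros H; exists (x / 2 * (x / 2 + 1) / 2).
  rewrite <- triangular_odd_square; replace (2 * (x / 2) + 1) with x by lia; ring.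
Qed.

Definition odd_sol (a b c m : Z) : Z * (Z * Z) -> Prop :=
  fun '(x, (y, z)) => x mod 2 = 1 /\ y mod 2 = 1 /\ z mod 2 = 1 /\
    a * (x * x) + b * (y * y) + c * (z * z) = m.

Lemma has_card_trep (a b c n : Z) :
  0 < a -> 0 < b -> 0 < c -> 0 <= n ->
  has_card (odd_sol a b c (8 * n + a + b + c)) (trep a b c n).
Proof.
  intros Ha Hb Hc Hn.
  eapply (has_card_bij
    (fun '(x, (y, z)) => (2 * x + 1, (2 * y + 1, 2 * z + 1)))
    (fun '(x, (y, z)) => (x / 2, (y / 2, z / 2))));
    [| |apply has_card_count3; [exact Hn|]].
  - intros (x, (y, z)); unfold odd_sol; rewrite Z.eqb_eq, !triangular_odd_square; intros ->.
    split; [repeat split; lia|apply triple_eq; lia].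
  - intros (x, (y, z)) (Hx & Hy & Hz & H).
    assert (Ex : x = 2 * (x / 2) + 1) by lia.
    assert (Ey : y = 2 * (y / 2) + 1) by lia.
    assert (Ez : z = 2 * (z / 2) + 1) by lia.
    split; [|apply triple_eq; lia].
    rewrite Z.eqb_eq.
    rewrite Ex, Ey, Ez, !triangular_odd_square in H; lia.
  - intros x y z; rewrite Z.eqb_eq; intros H.
    pose proof (triangular_odd_square x) as Tx.
    pose proof (triangular_odd_square y) as Ty.
    pose proof (triangular_odd_square z) as Tz.
    set (u := x * (x + 1) / 2) in *; set (v := y * (y + 1) / 2) in *;
      set (w := z * (z + 1) / 2) in *; clearbody u v w.
    assert (0 <= u) by nia; assert (0 <= v) by nia; assert (0 <= w) by nia.
    assert (Hle : forall d t, 0 < d -> 0 <= t -> 0 <= t <= d * t) by (intros; nia).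
    pose proof (Hle a u); pose proof (Hle b v); pose proof (Hle c w).
    repeat split; nia.
Qed.

(** * Choice of signs and the two isometries *)

(* [(x + 5 y) (x - 5 y) = x^2 - 25 y^2] is divisible by 32 or is 16 modulo 32,
   while exactly one factor is divisible by 4. *)
Lemma sign_choice (h x y : Z) :
  h = 0 \/ h = 8 -> x mod 2 = 1 -> y mod 2 = 1 ->
  (3 * (x * x) + 5 * (y * y)) mod 32 = (16 + 2 * h) mod 32 ->
  (x + 5 * y) mod 16 = h <-> (x - 5 * y) mod 16 <> h.
Proof.
  intros Hh Hx Hy H.
  (* For odd a, a^2 = 1 modulo 8. Multiplying 2 a b = h modulo 16 by a thus gives 2 b = a h modulo
     16, and a h = h there because h is 0 or 8. *)
  assert (Hodd : forall a b, a mod 2 = 1 -> 2 * ((a * b) mod 8) = h ->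
    (2 * b) mod 16 = h).
  { intros a b Ha Hab.
    destruct (odd_square a Ha) as [k Hk].
    assert (E : a * (a * b) = 8 * (k * b) + b) by (rewrite Z.mul_assoc, Hk; ring).
    assert (Hc : exists j, 2 * (a * b) = 16 * j + h)
      by (exists (a * b / 8); lia).
    destruct Hc as [j Hj].
    assert (E2 : 16 * (a * j) + a * h = 16 * (k * b) + 2 * b)
      by (replace (16 * (a * j) + a * h) with (a * (16 * j + h)) by ring;
          rewrite <- Hj; lia).
    clear E Hab Hj Hk; generalize dependent (k * b); generalize dependent (a * j).
    intros u v E2.
    destruct Hh; subst h; lia. }
  assert (Hp : exists a, x + 5 * y = 2 * a) by (exists ((x + 5 * y) / 2); lia).
  destruct Hp as [a Ha].
  assert (Hp : exists b, x - 5 * y = 2 * b) by (exists (a - 5 * y); lia).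
  destruct Hp as [b Hb].
  (* The difference a - b = 5 y is odd. *)
  assert (Hpar : a mod 2 = 1 \/ b mod 2 = 1) by lia.
  assert (E : x * x - 25 * (y * y) = 4 * (a * b)).
  { replace (x * x - 25 * (y * y)) with ((x + 5 * y) * (x - 5 * y)) by ring.
    rewrite Ha, Hb; ring. }
  destruct (odd_square y Hy) as [k Hk].
  (* Modulo 32, 80 y^2 = 16 for odd y, so 12 a b = 3 x^2 + 5 y^2 - 80 y^2 = 2 h; hence a b = h / 2
     modulo 8. *)
  assert (Hab : 2 * ((a * b) mod 8) = h).
  { clear - Hh H E Hk; revert H E Hk; generalize (x * x) (y * y) (a * b).
    intros u v w H E ->; destruct Hh as [->| ->]; lia. }
  clear H E Hk.
  destruct Hpar as [Hodd_a|Hodd_b].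
  - pose proof (Hodd a b Hodd_a Hab); clear Hab Hodd; lia.
  - rewrite Z.mul_comm with (n := a) in Hab.
    pose proof (Hodd b a Hodd_b Hab); clear Hab Hodd; lia.
Qed.

(** The isometry with X = x + 5 y, Y = 3 x - y has inverse (X + 5 Y) / 16, (3 X - Y) / 16, and 16
    dividing X + 5 Y makes both integral. By [sign_choice] exactly one sign of Y achieves this,
    whence the factor 2. The second identity uses c = 5, the fourth c = 3. *)
Lemma card_3_5_4c (c m : Z) (p : nat) :
  c mod 2 = 1 -> m mod 8 = (c + 4) mod 8 ->
  has_card (odd_sol 3 5 (4 * c) (4 * m)) p ->
  exists q, p = (2 * q)%nat /\
    has_card (fun '(x, (y, z)) =>
      z mod 2 = 1 /\ 12 * (x * x) + 20 * (y * y) + c * (z * z) = m) q.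
Proof.
  intros Hc Hm Hp.
  assert (Hmod : forall x y z, odd_sol 3 5 (4 * c) (4 * m) (x, (y, z)) ->
    (3 * (x * x) + 5 * (y * y)) mod 32 = (16 + 2 * 0) mod 32).
  { intros x y z (Hx & Hy & Hz & H).
    destruct (odd_square z Hz) as [k Hk]; rewrite Hk in H.
    assert (exists j, j = c * k) as [j Hj] by eauto.
    assert (4 * c * (8 * k + 1) = 32 * j + 4 * c) by (subst j; ring).
    lia_abstracting_products. }
  apply (has_card_halve (fun '(x, (y, z)) => (x, (- y, z)))
    (fun '(x, (y, z)) => (x + 5 * y) mod 16 =? 0)) in Hp as (q & Hq & ->).
  2:{ intros (x, (y, z)) Ht; pose proof (Hmod x y z Ht) as H32.
      destruct Ht as (Hx & Hy & Hz & H).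
      pose proof (sign_choice 0 x y (or_introl eq_refl) Hx Hy H32).
      repeat split; try lia; [now rewrite Z.opp_involutive|].
      replace (x + 5 * - y) with (x - 5 * y) by ring; lia. }
  exists q; split; [easy|]; revert Hq.
  apply (has_card_bij
    (fun '(x, (y, z)) => ((x + 5 * y) / 16, ((3 * x - y) / 16, z)))
    (fun '(x, (y, z)) => (x + 5 * y, (3 * x - y, z)))).
  - intros (x, (y, z)) [(Hx & Hy & Hz & H) H16%Z.eqb_eq].
    assert (exists k, x = 16 * k - 5 * y) as [k ->]
      by (exists ((x + 5 * y) / 16); lia).
    replace ((16 * k - 5 * y + 5 * y) / 16) with k by lia.
    replace ((3 * (16 * k - 5 * y) - y) / 16) with (3 * k - y) by lia.
    split; [split; lia|apply triple_eq; ring].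
  - intros (x, (y, z)) [Hz H].
    destruct (odd_square z Hz) as [k Hk].
    (* Modulo 8 the equation leaves 4 (3 x^2 + 5 y^2) = m - c = 4, so x and y have opposite parity
       and [x + 5 * y], [3 * x - y] are odd. *)
    assert (Hxy : (x + y) mod 2 = 1).
    { rewrite Hk in H.
      replace (c * (8 * k + 1)) with (8 * (c * k) + c) in H by ring.
      pose proof (square_mod_4 x); pose proof (square_mod_4 y).
      lia_abstracting_products. }
    split.
    + split; [|apply Z.eqb_eq; lia].
      repeat split; lia.
    + apply triple_eq; lia.
Qed.

(* The case [e = 3] serves the form [3 x^2 + 5 y^2 + 36 z^2]. *)
Lemma card_3_4_5 (e m : Z) (p q : nat) :
  (e | 3) -> m mod 8 = 1 ->
  has_card (fun t => odd_sol 3 4 5 (4 * m) t /\ (e | fst (snd t))) p ->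
  has_card (fun '(x, (y, z)) =>
    3 * (x * x) + 4 * (y * y) + 5 * (z * z) = m /\ (e | y)) q ->
  p = (2 * q)%nat.
Proof.
  intros He Hm Hp Hq.
  assert (Hmod : forall x y z, odd_sol 3 4 5 (4 * m) (x, (y, z)) ->
    (3 * (x * x) + 5 * (z * z)) mod 32 = (16 + 2 * 8) mod 32).
  { intros x y z (Hx & Hy & Hz & H).
    destruct (odd_square y Hy) as [k Hk]; lia_abstracting_products. }
  apply (has_card_halve (fun '(x, (y, z)) => (x, (y, - z)))
    (fun '(x, (y, z)) => (x + 5 * z) mod 16 =? 8)) in Hp as (p1 & Hp & ->).
  2:{ intros (x, (y, z)) [Ht Hey]; pose proof (Hmod x y z Ht) as H32.
      destruct Ht as (Hx & Hy & Hz & H).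
      pose proof (sign_choice 8 x z (or_intror eq_refl) Hx Hz H32).
      repeat split; try lia; auto; [now rewrite Z.opp_involutive|].
      replace (x + 5 * - z) with (x - 5 * z) by ring; lia. }
  (* With x + 5 z = 8 modulo 16 and y odd, x + 8 y + 5 z is divisible by 16. Changing the sign of y
     shifts it by 16 modulo 32, so exactly one sign makes it divisible by 32. *)
  apply (has_card_halve (fun '(x, (y, z)) => (x, (- y, z)))
    (fun '(x, (y, z)) => (x + 8 * y + 5 * z) mod 32 =? 0)) in Hp as (p2 & Hp & ->).
  2:{ intros (x, (y, z)) [[(Hx & Hy & Hz & H) Hey] H16]; simpl in Hey.
      repeat split; try lia; auto; try now rewrite Z.opp_involutive.
      - now apply Z.divide_opp_r.
      - clear H; lia. }
  (* Modulo 4 the equation forces x even and z odd; modulo 8 it then forces x / 2 + y odd. *)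
  assert (Hpar : forall x y z, 3 * (x * x) + 4 * (y * y) + 5 * (z * z) = m ->
    x mod 2 = 0 /\ z mod 2 = 1 /\ (x / 2 + y) mod 2 = 1).
  { intros x y z H.
    pose proof (square_mod_4 x); pose proof (square_mod_4 y);
      pose proof (square_mod_4 z).
    assert (Hxz : x mod 2 = 0 /\ z mod 2 = 1) by lia_abstracting_products.
    destruct Hxz as [Hx Hz]; destruct (odd_square z Hz) as [k Hk].
    assert (exists j, x = 2 * j) as [j ->] by (exists (x / 2); lia).
    replace (2 * j / 2) with j by lia.
    replace (2 * j * (2 * j)) with (4 * (j * j)) in * by ring.
    pose proof (square_mod_4 j).
    repeat split; lia_abstracting_products. }
  (* Images (2 k, 3 k - Y, 12 k - 3 Y - 2 Z) with Z odd satisfy k + y + z = 2 modulo 4. In general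
     this sum is even and moves by 2 modulo 4 when z changes sign. So p is four times, and q twice,
     the same number. *)
  apply (has_card_halve (fun '(x, (y, z)) => (x, (y, - z)))
    (fun '(x, (y, z)) => (x / 2 + y + z) mod 4 =? 2)) in Hq as (q1 & Hq & ->).
  2:{ intros (x, (y, z)) [H Hey]; pose proof (Hpar x y z H).
      repeat split; auto; try lia; now rewrite Z.opp_involutive. }
  enough (p2 = q1) by lia.
  refine (has_card_unique _ _ _ _ Hq); revert Hp.
  apply (has_card_bij
    (fun '(x, (y, z)) => let k := (x + 8 * y + 5 * z) / 32 in
       (2 * k, (3 * k - y, 12 * k - 3 * y - 2 * z)))
    (fun '(x, (y, z)) => let k := x / 2 in
       ((k + y + 5 * z) / 2, (3 * k - y, (3 * k + 3 * y - z) / 2)))).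
  - intros (x, (y, z)) [[[(Hx & Hy & Hz & H) Hey] H16] H32%Z.eqb_eq].
    simpl in Hey; cbv zeta.
    assert (exists k, x = 32 * k - 8 * y - 5 * z) as [k ->]
      by (exists ((x + 8 * y + 5 * z) / 32); lia).
    replace ((32 * k - 8 * y - 5 * z + 8 * y + 5 * z) / 32) with k by lia.
    split; [split; [split|]|].
    + lia.
    (* As e divides 3, passing from y to 3 k - y preserves divisibility by e. *)
    + apply Z.divide_sub_r; [now apply Z.divide_mul_l|exact Hey].
    + apply Z.eqb_eq; lia.
    + apply triple_eq; lia.
  - intros (x, (y, z)) [[H Hey] H4%Z.eqb_eq]; pose proof (Hpar x y z H).
    cbv beta iota zeta.
    assert (exists k, x = 2 * k) as [k ->] by (exists (x / 2); lia).
    replace (2 * k / 2) with k in * by lia.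
    assert (exists l, k = 4 * l + 2 - y - z) as [l ->]
      by (exists ((k + y + z) / 4); lia).
    set (k := 4 * l + 2 - y - z) in *.
    replace ((k + y + 5 * z) / 2) with (2 * l + 1 + 2 * z) by (unfold k; lia).
    replace ((3 * k + 3 * y - z) / 2) with (6 * l + 3 - 2 * z) by (unfold k; lia).
    split; [split; [split; [split|]|]|].
    + unfold odd_sol, k in *; repeat split; [clear H; lia..|lia].
    + apply Z.divide_sub_r; [now apply Z.divide_mul_l|exact Hey].
    + apply Z.eqb_eq; unfold k; lia.
    + apply Z.eqb_eq; unfold k; lia.
    + unfold k; apply triple_eq; lia.
Qed.

(** * The four identities *)

Theorem theorem6p1 (n : Z) (hn : 0 < n) :
  (n mod 4 = 3 -> Z.of_nat (trep 3 4 5 n) = 2 * Z.of_nat (Nrep 3 4 5 (2 * n + 3))) /\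
  (n mod 4 = 1 -> Z.of_nat (trep 3 5 20 n) = 2 * Z.of_nat (Nrep 3 5 20 (2 * n + 7))) /\
  (n mod 4 = 3 -> Z.of_nat (trep 3 5 36 n) = 2 * Z.of_nat (Nrep 3 5 36 (2 * n + 11))) /\
  (n mod 4 = 1 -> 2 * Z.of_nat (trep 3 5 12 n) = Z.of_nat (Nrep 3 5 12 (8 * n + 20))).
Proof.
  split; [|split; [|split]]; intros Hn.
  - enough (trep 3 4 5 n = (2 * Nrep 3 4 5 (2 * n + 3))%nat) by lia.
    apply (card_3_4_5 1 (2 * n + 3)); [apply Z.divide_1_l|lia| |].
    + eapply has_card_ext; [|apply has_card_trep; lia].
      replace (8 * n + 3 + 4 + 5) with (4 * (2 * n + 3)) by ring.
      intros t; pose proof (Z.divide_1_l (fst (snd t))); tauto.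
    + eapply has_card_ext; [|apply has_card_Nrep; lia].
      intros (x, (y, z)); pose proof (Z.divide_1_l y); tauto.
  - pose proof (has_card_trep 3 5 20 n) as Ht.
    replace (8 * n + 3 + 5 + 20) with (4 * (2 * n + 7)) in Ht by ring.
    apply (card_3_5_4c 5) in Ht as (q & Hq & Hcard); [|lia..].
    enough (q = Nrep 3 5 20 (2 * n + 7)) by lia.
    refine (has_card_unique _ _ _ _ (has_card_Nrep 3 5 20 (2 * n + 7) _ _ _ _)); try lia.
    revert Hcard; apply (has_card_bij
      (fun '(x, (y, z)) => (2 * x, (z, y)))
      (fun '(x, (y, z)) => (x / 2, (z, y)))).
    + intros (x, (y, z)) [Hz H]; split; [lia|apply triple_eq; lia].
    + intros (x, (y, z)) H.
      (* Here 2 n + 7 = 1 modulo 4, and 3 x^2 + 5 y^2 = 1 modulo 4 only for x even and y odd. *)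
      assert (Hxy : x mod 2 = 0 /\ y mod 2 = 1).
      { destruct (Z.Even_or_Odd x) as [[i ->]|[i ->]];
          destruct (Z.Even_or_Odd y) as [[j ->]|[j ->]]; lia. }
      assert (exists k, x = 2 * k) as [k ->] by (exists (x / 2); lia).
      replace (2 * k / 2) with k by lia.
      split; [lia|easy].
  - enough (trep 3 5 36 n = (2 * Nrep 3 5 36 (2 * n + 11))%nat) by lia.
    assert (Hdiv : forall y, (3 | 3 * y)) by (intros y; exists y; ring).
    apply (card_3_4_5 3 (2 * n + 11)); [apply Z.divide_refl|lia| |].
    (* Writing 36 z^2 = 4 (3 z)^2 turns this form into 3 x^2 + 4 y^2 + 5 z^2 with 3 dividing y. *)
    + eapply (has_card_bij (fun '(x, (y, z)) => (x, (3 * z, y)))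
        (fun '(x, (y, z)) => (x, (z, y / 3))));
        [| |apply (has_card_trep 3 5 36 n); lia].
      * intros (x, (y, z)) (Hx & Hy & Hz & H).
        split; [split; [unfold odd_sol; repeat split; lia|apply Hdiv]|apply triple_eq; lia].
      * intros (x, (y, z)) [(Hx & Hy & Hz & H) [k Hk]]; simpl in Hk; subst y.
        rewrite Z.div_mul by easy.
        split; [unfold odd_sol; repeat split; lia|apply triple_eq; lia].
    + eapply (has_card_bij (fun '(x, (y, z)) => (x, (3 * z, y)))
        (fun '(x, (y, z)) => (x, (z, y / 3))));
        [| |apply (has_card_Nrep 3 5 36 (2 * n + 11)); lia].
      * intros (x, (y, z)) H.
        split; [split; [lia|apply Hdiv]|apply triple_eq; lia].
      * intros (x, (y, z)) [H [k ->]].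
        rewrite Z.div_mul by easy.
        split; [lia|apply triple_eq; lia].
  (* Representations of 4 (2 n + 5) with x odd have all variables odd and are counted by t. The
     claim is thus that as many have x even. Both numbers are twice the number of solutions of 12
     x^2 + 20 y^2 + 3 z^2 = 2 n + 5 with z odd. *)
  - pose proof (has_card_trep 3 5 12 n) as Ht.
    replace (8 * n + 3 + 5 + 12) with (4 * (2 * n + 5)) in Ht by ring.
    pose proof (has_card_Nrep 3 5 12 (8 * n + 20)) as HN.
    replace (8 * n + 20) with (4 * (2 * n + 5)) in HN |- * by ring.
    apply (has_card_split (fun '(x, (y, z)) => x mod 2 =? 1)) in HN
      as (p & q & Hp & Hq & HN); [|lia..].
    assert (Ep : trep 3 5 12 n = p).
    { refine (has_card_unique _ _ _ (Ht _ _ _ _) _); try lia.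
      eapply has_card_ext; [|exact Hp].
      intros (x, (y, z)); rewrite Z.eqb_eq; unfold odd_sol; split; [|tauto].
      intros [H Hx].
      destruct (odd_square x Hx) as [i Hi].
      assert (Hy : y mod 2 = 1).
      { destruct (Z.Even_or_Odd y) as [[j ->]|[j ->]]; lia. }
      destruct (odd_square y Hy) as [j Hj].
      repeat split; try easy.
      destruct (Z.Even_or_Odd z) as [[k ->]|[k ->]]; lia_abstracting_products. }
    assert (Hhalf : has_card (fun '(x, (y, z)) =>
        3 * (x * x) + 5 * (y * y) + 3 * (z * z) = 2 * n + 5) q).
    { revert Hq; apply (has_card_bij
        (fun '(x, (y, z)) => (x / 2, (y / 2, z)))
        (fun '(x, (y, z)) => (2 * x, (2 * y, z)))).
      - intros (x, (y, z)) [H Hx%Z.eqb_neq].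
        assert (exists i, x = 2 * i) as [i ->] by (exists (x / 2); lia).
        destruct (Z.Even_or_Odd y) as [[j ->]|[j ->]]; [|lia].
        replace (2 * i / 2) with i by lia; replace (2 * j / 2) with j by lia.
        split; [lia|easy].
      - intros (x, (y, z)) H.
        split; [split; [lia|apply Z.eqb_neq; lia]|apply triple_eq; lia]. }
    assert (Hpar : forall x y z,
      3 * (x * x) + 5 * (y * y) + 3 * (z * z) = 2 * n + 5 ->
      y mod 2 = 0 /\ (x + z) mod 2 = 1).
    { intros x y z H.
      pose proof (square_mod_4 x); pose proof (square_mod_4 y);
        pose proof (square_mod_4 z).
      (* For odd y, modulo 4 only all three odd survives; then modulo 8 the left side is 3 while 2 n
         + 5 is 7. *)
      assert (Hy : y mod 2 = 0 \/ x mod 2 = 1 /\ y mod 2 = 1 /\ z mod 2 = 1)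
        by lia_abstracting_products.
      destruct Hy as [Hy|(Hx & Hy & Hz)]; [split; lia_abstracting_products|].
      destruct (odd_square x Hx); destruct (odd_square y Hy);
        destruct (odd_square z Hz); lia_abstracting_products. }
    (* Since x and z have equal coefficients and opposite parity, swapping them is the required
       involution. *)
    apply (has_card_halve (fun '(x, (y, z)) => (z, (y, x)))
      (fun '(x, (y, z)) => z mod 2 =? 1)) in Hhalf as (q' & Hq' & ->).
    2:{ intros (x, (y, z)) H; pose proof (Hpar x y z H).
        repeat split; lia. }
    apply (card_3_5_4c 3) in Ht as (r & Hr & Hcard); [|lia..].
    enough (q' = r) by lia.
    refine (has_card_unique _ _ _ _ Hcard); revert Hq'.
    apply (has_card_bij
      (fun '(x, (y, z)) => (x / 2, (y / 2, z)))
      (fun '(x, (y, z)) => (2 * x, (2 * y, z)))).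
    + intros (x, (y, z)) [H Hz%Z.eqb_eq]; pose proof (Hpar x y z H).
      assert (exists i, x = 2 * i) as [i ->] by (exists (x / 2); lia).
      assert (exists j, y = 2 * j) as [j ->] by (exists (y / 2); lia).
      replace (2 * i / 2) with i by lia; replace (2 * j / 2) with j by lia.
      split; [lia|easy].
    + intros (x, (y, z)) [Hz H].
      split; [split; [lia|now apply Z.eqb_eq]|apply triple_eq; lia].
Qed.
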